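(* For every integer $t\ge4$ there exists a graph $G_t$ that is $K_t$-minor free and satisfies $\chi(G_t^{[\natural 3]})\ge 2(t-2)+1$.
   Context: All graphs are finite, undirected, simple and without loops. $\chi$ denotes the chromatic number. A graph is $K_t$-minor free if it does not contain the complete graph $K_t$ as a minor. For a graph $G=(V,E)$ and a positive integer $p$, the exact distance-$p$ graph $G^{[\natural p]}$ has vertex set $V$, and $xy$ is an edge if and only if the distance between $x$ and $y$ in $G$ is exactly $p$. *)

(* Defs.v *)
From mathcomp Require Import all_boot.

Set Implicit Arguments.
Unset Strict Implicit.
Unset Printing Implicit Defensive.

Record sgraph := SGraph {
  vertex :> finType;
  edge : rel vertex;
  edge_sym : symmetric edge;
  edge_irr : irreflexive edge }.

Arguments edge {G} x y : rename.

Section Complete.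
Variable t : nat.

Let ke : rel 'I_t := fun i j => i != j.

Fact complete_sym : symmetric ke.
Proof. by move=> i j; rewrite /ke eq_sym. Qed.

Fact complete_irr : irreflexive ke.
Proof. by move=> i; rewrite /ke eqxx. Qed.

Definition complete : sgraph := SGraph complete_sym complete_irr.

End Complete.

(* The subgraph of G induced by S is connected (vacuously so if S is empty). *)
Definition connected_in (G : sgraph) (S : {set G}) : Prop :=
  {in S &, forall x y,
    connect [rel u v | [&& u \in S, v \in S & edge u v]] x y}.

(* H is a minor of G: the sets phi x are the branch sets, i.e. the parts of G
   contracted to the vertices of H; vertices outside all of them are deleted. *)
Definition minor (H G : sgraph) : Prop :=
  exists phi : H -> {set G},
    [/\ forall x, phi x != set0,
        forall x, connected_in (phi x),
        forall x y, x != y -> [disjoint phi x & phi y]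
      & forall x y, edge x y ->
          exists u v, [/\ u \in phi x, v \in phi y & edge u v]].

Definition minor_free (H G : sgraph) : Prop := ~ minor H G.

Section Distance.
Variable G : sgraph.

(* There is a path (no repeated vertex) with n edges from x to y. *)
Definition has_path (n : nat) (x y : G) : bool :=
  [exists p : n.-tuple G,
    [&& path edge x p, uniq (x :: p) & last x p == y]].

(* The distance from x to y is n: a shortest path from x to y has length n.
   Vertices in different components are at no finite distance. *)
Definition at_distance (n : nat) (x y : G) : bool :=
  has_path n x y && [forall m : 'I_n, ~~ has_path m x y].

Lemma has_pathP n x y :
  reflect (exists p, [/\ path edge x p, uniq (x :: p), last x p = y
                       & size p = n])
          (has_path n x y).
Proof.
apply: (iffP existsP) => [[p /and3P[px up /eqP ly]] | [p [px up ly sp]]].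
  by exists p; rewrite size_tuple.
have sp' : size p == n by apply/eqP.
by exists (Tuple sp'); apply/and3P; split=> //; apply/eqP.
Qed.

Lemma has_path_sym n : symmetric (has_path n).
Proof.
suff imp x y : has_path n x y -> has_path n y x.
  by move=> x y; apply/idP/idP; apply: imp.
case/has_pathP=> p [px up ly sp]; apply/has_pathP.
exists (rev (belast x p)); split.
- rewrite -ly rev_path; rewrite (eq_path (e' := edge)) // => u v.
  exact: edge_sym.
- by rewrite -ly -rev_rcons -lastI rev_uniq.
- by case: p {px up sp} ly => [|z p] //= _; rewrite rev_cons last_rcons.
- by rewrite size_rev size_belast.
Qed.

Lemma at_distance_sym n : symmetric (at_distance n).
Proof.
move=> x y; rewrite /at_distance has_path_sym; congr (_ && _).
by apply: eq_forallb => m; rewrite has_path_sym.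
Qed.

End Distance.

Section ExactDistance.
Variables (G : sgraph) (p : nat).

(* For p > 0 the condition x != y is implied by the other one; it only
   excludes loops in the degenerate case p = 0. *)
Let ee : rel G := fun x y => (x != y) && at_distance p x y.

Fact exact_dist_sym : symmetric ee.
Proof. by move=> x y; rewrite /ee eq_sym at_distance_sym. Qed.

Fact exact_dist_irr : irreflexive ee.
Proof. by move=> x; rewrite /ee eqxx. Qed.

Definition exact_dist_graph : sgraph := SGraph exact_dist_sym exact_dist_irr.

End ExactDistance.

Lemma exact_dist_edgeE (G : sgraph) p (x y : G) : 0 < p ->
  @edge (exact_dist_graph G p) x y = at_distance p x y.
Proof.
move=> p_gt0 /=; have [<-|//] := eqVneq x y.
apply/esym/negbTE; rewrite negb_and negb_forall; apply/orP; right.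
apply/existsP; exists (Ordinal p_gt0); rewrite negbK.
by apply/has_pathP; exists [::].
Qed.

Definition colorable (G : sgraph) (k : nat) : bool :=
  [exists c : {ffun G -> 'I_k},
    [forall x, forall y, edge x y ==> (c x != c y)]].

Fact colorable_ex (G : sgraph) : exists k, colorable G k.
Proof.
exists #|G|; apply/existsP; exists [ffun x => enum_rank x].
apply/'forall_forallP => x y; apply/implyP => xy; rewrite !ffunE.
apply: contraTneq xy => /enum_rank_inj->; by rewrite edge_irr.
Qed.

Definition chromatic_number (G : sgraph) : nat := ex_minn (colorable_ex G).

(* Main.v *)
Require Import Defs.
From mathcomp Require Import all_boot.
From mathcomp Require Import zify.

Set Implicit Arguments.
Unset Strict Implicit.
Unset Printing Implicit Defensive.

(* The graphs have treewidth at most t - 2, witnessed by a chordal completion,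
   which excludes K_t as a minor.
   Induction step: take a triangle r0 r1 r2 and, for i = 0, 1, attach to r_i a
   pendant vertex p_i and a copy of H joined to r_i by a path of length 2 from
   each of its vertices.  Distances at most 4 in H are preserved, and p_i and r2
   are at distance 3 from the whole copy at r_i.  If H needs m colours and only
   m + 1 are available, then p_i and r2 must share their colour for both i,
   although p_0 and p_1 are at distance 3.
   Base case t = 4, a tree of triangles with two child triangles at each vertex:
   suppose four colours suffice, let S1 w and S2 w be the colours of the children
   and grandchildren of w, and call w full if S1 w and S2 w cover all colours.
   Siblings have disjoint S1 and are not both full (the colour of their parent
   would lie in both S1).  If S1 w is a singleton and w is not full, then so is
   some child, and two generations later at most one colour is left for
   S2, which contains two disjoint nonempty sets; hence S1 w singleton forces w
   full, and this fails at the children of the root. *)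

(** * Elimination orders and complete minors *)

(* Treewidth at most k: u \in B v orients the edges of a chordal supergraph,
   B v being the earlier neighbours of v in an elimination order. *)
Definition elim_width (k : nat) (G : sgraph) : Prop :=
  exists (lev : G -> nat) (B : G -> seq G),
  [/\ forall v, size (B v) <= k,
      forall u v, u \in B v -> lev u < lev v,
      forall u v : G, edge u v -> (u \in B v) || (v \in B u)
    & forall v, {in B v &, forall u w, u != w -> (u \in B w) || (w \in B u)}].

Section ElimWidth.
Variables (G : sgraph) (k : nat) (lev : G -> nat) (B : G -> seq G).
Hypothesis size_B : forall v, size (B v) <= k.
Hypothesis lev_B : forall u v, u \in B v -> lev u < lev v.
Hypothesis edge_B : forall u v : G, edge u v -> (u \in B v) || (v \in B u).
Hypothesis clique_B :
  forall v, {in B v &, forall u w, u != w -> (u \in B w) || (w \in B u)}.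

Let below (a m : G) := connect [rel u w | w \in B u] a m.

Lemma below_step a b m : b \in B a -> below b m -> below a m.
Proof. by move=> ba bm; apply: connect_trans bm; apply: connect1. Qed.

Lemma below_lev a m : below a m -> (a == m) || (lev m < lev a).
Proof.
case/connectP=> p; elim: p a => [|b p IH] a /=; first by move=> _ ->; rewrite eqxx.
case/andP=> /lev_B ba bp lm; case/orP: (IH b bp lm) => [/eqP <-|mb].
  by rewrite ba orbT.
by rewrite (ltn_trans mb ba) orbT.
Qed.

(** On the descent from [a] to [m], [b] and the next vertex are both in [B a], hence joined. As [b]
    does not descend to [m], [b] must be the earlier of the two, and this repeats down to [m]. *)
Lemma below_exit_B a b m :
  below a m -> b \in B a -> ~~ below b m -> b \in B m.
Proof.
case/connectP=> p; elim: p a => [|a' p IH] a /=; first by move=> _ ->.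
case/andP=> a'a pp lm ba nb.
have a'm : below a' m by apply/connectP; exists p.
have na' : b != a' by apply: contraNneq nb => ->.
case/orP: (clique_B ba a'a na') => [ba'|a'b]; first exact: IH pp lm ba' nb.
by rewrite (below_step a'b a'm) in nb.
Qed.

Lemma edge_exit a b m : below a m -> edge a b -> ~~ below b m -> b \in B m.
Proof.
move=> am /edge_B/orP[ab|ba]; last exact: below_exit_B ba.
by rewrite (below_step ab am).
Qed.

(** A path in [S] from [a] to [b] has a first edge leaving the set of vertices that descend to [m];
    [edge_exit] applies to it. *)
Lemma connected_exit (S : {set G}) a b m :
  connected_in S -> a \in S -> b \in S -> below a m -> ~~ below b m ->
  exists2 z, z \in S & z \in B m.
Proof.
move=> cS aS bS; case/connectP: (cS a b aS bS) => p.
elim: p a {aS} => [|a' p IH] a /=; first by move=> _ -> am /negP[].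
case/andP=> /and3P[_ a'S aa'] pp lb am nb.
case: (boolP (below a' m)) => [a'm|na']; first exact: IH pp lb a'm nb.
by exists a' => //; apply: edge_exit aa' na'.
Qed.

Lemma complete_minor_width t : minor (complete t) G -> t <= k.+1.
Proof.
case=> phi [ne con dis adj].
have [->//|t_gt0] := posnP t.
have /fin_all_exists[m mP] (i : 'I_t) :
    exists m, m \in phi i /\ forall x, x \in phi i -> lev m <= lev x.
  case/set0Pn: (ne i) => x0 x0i.
  by case: (arg_minnP lev x0i) => m mi mm; exists m.
(* Otherwise [phi i] would meet [B (m i)], strictly below its lowest vertex. *)
have phi_below i x : x \in phi i -> below x (m i).
  case: (mP i) => mi mm xi; case: (boolP (below x (m i))) => // nx.
  have [z /mm le_z /lev_B] := connected_exit (con i) mi xi (connect0 _ _) nx.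
  by rewrite ltnNge le_z.
pose i0 : 'I_t := Ordinal t_gt0.
(* With the highest of the minima as [m j], the other [t - 1] branch sets all meet [B (m j)]: each
   has a vertex adjacent to [phi j], while its own minimum does not descend to [m j]. *)
have [j _ maxj] := arg_maxnP (fun i => lev (m i)) (isT : xpredT i0).
have ex i : i != j -> exists z, z \in phi i /\ z \in B (m j).
  move=> ij; have [u [v [ui vj uv]]] := adj _ _ ij.
  have vm := phi_below _ _ vj.
  case: (boolP (below u (m j))) => [um|nu]; last first.
    by exists u; split=> //; apply: edge_exit vm _ nu; rewrite edge_sym.
  have [mi _] := mP i; have [mj _] := mP j.
  have nm : ~~ below (m i) (m j).
    apply/negP=> /below_lev/orP[/eqP e|]; last by rewrite ltnNge (maxj i isT : _ <= _).
    by move/disjointFr: (dis _ _ ij) => /(_ _ mi); rewrite e mj.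
  by have [z] := connected_exit (con i) ui mi um nm; exists z.
have /fin_all_exists[g gP] (i : 'I_t) :
    exists z, i != j -> z \in phi i /\ z \in B (m j).
  by have [->|/ex[z]] := eqVneq i j; [exists (m j) | exists z].
have inj : {in [pred i | i != j] &, injective g}.
  move=> i i' ij i'j e; apply/eqP/negPn/negP=> ii'.
  have [gi _] := gP _ ij; have [gi' _] := gP _ i'j.
  by move/disjointFr: (dis _ _ ii') => /(_ _ gi); rewrite e gi'.
have : size [seq g i | i in [pred i | i != j]] <= size (B (m j)).
  apply: uniq_leq_size.
    by rewrite map_inj_in_uniq ?enum_uniq // => x y; rewrite !mem_enum; apply: inj.
  by move=> z /mapP[i]; rewrite mem_enum => /gP[_ h] ->.
rewrite size_map -cardE => /leq_trans/(_ (size_B _)).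
have := cardC1 j; rewrite card_ord => -> ; lia.
Qed.

End ElimWidth.

Lemma elim_width_minor_free k G : elim_width k G -> minor_free (complete k.+2) G.
Proof.
case=> lev [B [h1 h2 h3 h4]] /(complete_minor_width h1 h2 h3 h4).
by rewrite ltnn.
Qed.

(** * Distance 3 and the number of colours *)

(** A walk of length 3 and none of length 0, 1 or 2. A bare relation is used so that the infinite
    graph of all words is covered too. *)
Definition dist3 (T : Type) (e : rel T) (x y : T) : Prop :=
  [/\ exists a b, [/\ e x a, e a b & e b y],
      x <> y, ~~ e x y & forall z, ~~ (e x z && e z y)].

Lemma at_distance3P (G : sgraph) (x y : G) :
  at_distance 3 x y <-> dist3 edge x y.
Proof.
split.
  case/andP=> /has_pathP[p [pp up lp sp]] /forallP nm; split.
  - case: p pp {up} lp sp => [|a [|b [|c [|//]]]] //= /and4P[xa ab bc _] <- _.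
    by exists a, b.
  - move=> e; move: (nm ord0); rewrite -e; case/negP.
    by apply/has_pathP; exists [::].
  - apply: contra (nm (Ordinal (isT : 1 < 3))) => xy.
    apply/has_pathP; exists [:: y]; split=> //=; first by rewrite xy.
    by rewrite inE andbT; apply: contraTneq xy => ->; rewrite edge_irr.
  - move=> z; apply: contra (nm (Ordinal (isT : 2 < 3))) => /andP[xz zy].
    apply/has_pathP; exists [:: z; y]; split=> //=; first by rewrite xz zy.
    rewrite !inE andbT negb_or; apply/andP; split; last first.
      by apply: contraTneq zy => ->; rewrite edge_irr.
    apply/andP; split; first by apply: contraTneq xz => ->; rewrite edge_irr.
    apply/eqP=> e; move: (nm ord0); rewrite -e; case/negP.
    by apply/has_pathP; exists [::].
case=> [[a [b [xa ab bc]]] /eqP xy nxy nz].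
have D (u v : G) : edge u v -> u != v.
  by move=> uv; apply: contraTneq uv => ->; rewrite edge_irr.
apply/andP; split.
  apply/has_pathP; exists [:: a; b; y]; split=> //=; first by rewrite xa ab bc.
  rewrite !inE !negb_or xy (D _ _ xa) (D _ _ ab) (D _ _ bc) /= !andbT; apply/andP; split.
    by apply: contraNneq nxy => ->.
  by apply: contraNneq nxy => <-.
apply/forallP=> -[m /= m3]; apply/negP=> /has_pathP[p [pp up lp sp]].
case: m m3 sp => [|[|[|//]]] _.
- by case: p pp up lp => //= _ _ e _; rewrite e eqxx in xy.
- case: p pp up lp => [|c [|//]] //= /andP[xc _] _ e _.
  by rewrite -e xc in nxy.
- case: p pp up lp => [|c [|d [|//]]] //= /and3P[xc cd _] _ e _.
  by move: (nz c); rewrite xc -e cd.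
Qed.

Definition proper3 (G : sgraph) (C : Type) (f : G -> C) : Prop :=
  forall x y, dist3 edge x y -> f x <> f y.

(* Quantifying over all finite types of colours, rather than 'I_k, allows
   passing to the colours that avoid a given set. *)
Definition needs_colors (m : nat) (G : sgraph) : Prop :=
  forall (C : finType) (f : G -> C), proper3 f -> m <= #|C|.

Lemma needs_chromatic m G :
  needs_colors m G -> m <= chromatic_number (exact_dist_graph G 3).
Proof.
move=> nG; rewrite /chromatic_number; case: ex_minnP => n /existsP[c cP] _.
rewrite -(card_ord n); apply: (nG _ (c : G -> 'I_n)) => x y /at_distance3P xy.
move/forallP/(_ x)/forallP/(_ y): cP; rewrite exact_dist_edgeE // xy.
by move/eqP.
Qed.

Lemma needs_avoid m (G : sgraph) (C : finType) (f : G -> C) (A : {set C}) :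
  needs_colors m G -> proper3 f -> (forall x, f x \notin A) -> m + #|A| <= #|C|.
Proof.
move=> nG pf fA; pose D := {z : C | z \notin A}.
have : m <= #|{: D}|.
  apply: (nG D (fun x => exist _ (f x) (fA x))) => x y /pf ne e.
  by apply: ne; move: e => /(congr1 val).
rewrite card_sig => mD.
have -> : #|C| = #|~: A| + #|A| by rewrite addnC cardsC.
rewrite leq_add2r; apply: leq_trans mD _.
by apply: subset_leq_card; apply/subsetP=> z; rewrite !inE.
Qed.

(** * Induction step: two more colours for one more unit of width *)

Section ConeTriangle.
Variable H : sgraph.

(* third is r2; root i, pend i, subd i h, copy i h are r_i, p_i, the middle of
   the path from r_i to h, and the vertex h of the copy of H at r_i. *)
Definition cone_vertex : finType := option (bool * (bool + bool * H)).

Definition third : cone_vertex := None.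
Definition root i : cone_vertex := Some (i, inl true).
Definition pend i : cone_vertex := Some (i, inl false).
Definition subd i h : cone_vertex := Some (i, inr (true, h)).
Definition copy i h : cone_vertex := Some (i, inr (false, h)).

Let arc (x y : cone_vertex) : bool :=
  match x, y with
  | None, Some (_, inl b) => b
  | Some (i, inl b), Some (j, inl c) => if b then [&& i, ~~ j & c] else (i == j) && c
  | Some (i, inr (true, _)), Some (j, inl c) => (i == j) && c
  | Some (i, inr (true, h)), Some (j, inr (false, h')) => (i == j) && (h == h')
  | Some (i, inr (false, h)), Some (j, inr (false, h')) => (i == j) && edge h h'
  | _, _ => false
  end.

Definition cone_edge : rel cone_vertex := fun x y => arc x y || arc y x.

Fact cone_sym : symmetric cone_edge.
Proof. by move=> x y; rewrite /cone_edge orbC. Qed.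

Fact cone_irr : irreflexive cone_edge.
Proof.
by rewrite /cone_edge; case=> [[[] [[]|[[] h]]]|] //=; rewrite edge_irr.
Qed.

Definition cone_triangle : sgraph := SGraph cone_sym cone_irr.

Lemma cone_triangle_width k :
  0 < k -> elim_width k H -> elim_width k.+1 cone_triangle.
Proof.
move=> k_gt0 [lev [B [sB lB eB cB]]].
(* The completion joins [root i] to its whole copy, which enlarges each [B h] by one. The vertex
   [subd i h] comes after its two neighbours, which are then joined. *)
pose lev' (x : cone_triangle) := match x with
  | None => 2
  | Some (i, inl true) => i : nat
  | Some (i, inl false) => 2
  | Some (i, inr (false, h)) => (lev h).+2
  | Some (i, inr (true, h)) => (lev h).+3
  end.
pose B' (x : cone_triangle) : seq cone_triangle := match x with
  | None => [:: root false; root true]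
  | Some (i, inl true) => if i then [:: root false] else [::]
  | Some (i, inl false) => [:: root i]
  | Some (i, inr (false, h)) => root i :: [seq copy i h' | h' <- B h]
  | Some (i, inr (true, h)) => [:: root i; copy i h]
  end.
have mB i h h' : h' \in B h -> copy i h' \in B' (copy i h).
  by move=> hh; rewrite /= inE map_f ?orbT.
exists lev', B'; split.
- case=> [[[] [[]|[[] h]]]|] //=; rewrite ?ltnS ?size_map //.
- move=> u [[i [[]|[[] h]]]|] /=.
  + by case: i; rewrite ?inE //= => /eqP->.
  + by rewrite inE => /eqP->; case: i.
  + by rewrite !inE => /orP[]/eqP->; case: i => //=; lia.
  + by rewrite inE => /orP[/eqP->|/mapP[h' /lB hh ->]] /=; case: (i) => //=; lia.
  + by rewrite !inE => /orP[]/eqP->.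
- have E (u v : cone_triangle) : arc u v -> (u \in B' v) || (v \in B' u).
    by case: u v => [[[] [[]|[[] h]]]|] [[[] [[]|[[] h']]]|] //=; rewrite ?inE //=;
      [ move/eqP-> | move/eB/orP=> [] /(map_f (copy true)) ->
      | move/eqP-> | move/eB/orP=> [] /(map_f (copy false)) -> ];
      rewrite ?eqxx ?orbT.
  by move=> u v /orP[/E//|/E]; rewrite orbC.
case=> [[i [[]|[[] h]]]|] u w /=.
- by case: i; rewrite ?inE // => /eqP-> /eqP->; rewrite ?eqxx.
- by rewrite !inE => /eqP-> /eqP->; rewrite eqxx.
- by rewrite !inE => /orP[]/eqP-> /orP[]/eqP->; rewrite ?eqxx //= !inE eqxx ?orbT.
- have rB h' : root i \in B' (copy i h') by rewrite /= inE eqxx.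
  rewrite !inE => /orP[/eqP->|/mapP[x xh ->]] /orP[/eqP->|/mapP[y yh ->]];
    rewrite ?rB ?orbT ?eqxx //.
  move=> ne; have xy : x != y by apply: contraNneq ne => ->.
  by case/orP: (cB _ _ _ xh yh xy) => /mB->; rewrite ?orbT.
- by rewrite !inE => /orP[]/eqP-> /orP[]/eqP->; rewrite ?eqxx.
Qed.

Lemma dist3_pend : @dist3 cone_triangle edge (pend false) (pend true).
Proof.
split=> //; first by exists (root false), (root true).
by case=> [[[] [[]|[[] h]]]|].
Qed.

Lemma dist3_copy_third i h : @dist3 cone_triangle edge (copy i h) third.
Proof.
split=> //; last by case=> [[j [[]|[[] h']]]|] /=; rewrite /cone_edge /= ?andbF.
exists (subd i h), (root i); split=> //=; rewrite /cone_edge /= ?eqxx //.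
Qed.

Lemma dist3_copy_pend i h : @dist3 cone_triangle edge (copy i h) (pend i).
Proof.
split=> //; last by case=> [[j [[]|[[] h']]]|] /=; rewrite /cone_edge /= ?andbF.
by exists (subd i h), (root i); split=> //=; rewrite /cone_edge /= ?eqxx ?orbT.
Qed.

(** No shortcut of length 2 leaves the copy: the only outside neighbour of [copy i h] is [subd i h],
    which has no other neighbour in the copy. *)
Lemma dist3_copy i h h' :
  dist3 edge h h' -> @dist3 cone_triangle edge (copy i h) (copy i h').
Proof.
case=> [[a [b [ha ab bh]]] ne nhh' nz].
have E x y : @edge cone_triangle (copy i x) (copy i y) = edge x y.
  by rewrite /= /cone_edge /= eqxx /= [edge y x]edge_sym orbb.
split; rewrite ?E //.
- by exists (copy i a), (copy i b); rewrite !E.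
- by case.
case=> [[j [[]|[[] z]]]|] //=; rewrite /cone_edge /= ?andbF ?orbF //.
  apply/negP=> /andP[/andP[_ /eqP->] /andP[_ /eqP e]]; exact: ne.
have := nz z; rewrite [edge z h]edge_sym [edge h' z]edge_sym eq_sym.
by case: (j == i) => //=; rewrite !orbb.
Qed.

Lemma cone_triangle_needs m :
  needs_colors m H -> needs_colors m.+2 cone_triangle.
Proof.
move=> nH C c pc; rewrite leqNgt; apply/negP=> small.
have thirdE i : c (pend i) = c third.
  apply/eqP/negPn/negP=> ne.
  (* The copy avoids both colours, so if they differ it forces [m + 2] colours. *)
  have := @needs_avoid _ _ _ (fun h => c (copy i h)) [set c (pend i); c third] nH.
  rewrite cards2 ne addn2 leqNgt small => F; suff: false by [].
  apply: F; first by move=> x y /(dist3_copy i)/pc.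
  move=> h; rewrite !inE negb_or; apply/andP; split; apply/eqP; apply: pc.
    exact: dist3_copy_pend.
  exact: dist3_copy_third.
by apply: (pc _ _ dist3_pend); rewrite !thirdE.
Qed.

End ConeTriangle.

(** * Base case: the tree of triangles *)

(* A word is a vertex of the tree of triangles, its head being the last step;
   (k, false) :: w and (k, true) :: w form the k-th child triangle with w. *)
Definition word := seq (bool * bool).

Definition parent_of (u v : word) : bool := if v is _ :: w then w == u else false.
Definition sibling (u v : word) : bool :=
  if u is (k, s) :: w then v == (k, ~~ s) :: w else false.
Definition word_adj : rel word :=
  fun u v => [|| parent_of u v, parent_of v u | sibling u v].

Lemma sibling_sym : symmetric sibling.
Proof.
suff imp u v : sibling u v -> sibling v u by move=> u v; apply/idP/idP; apply: imp.
by case: u => [|[k s] w] //= /eqP->; rewrite /= negbK.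
Qed.

Lemma word_adj_sym : symmetric word_adj.
Proof. by move=> u v; rewrite /word_adj sibling_sym orbCA. Qed.

Lemma word_adj_irr : irreflexive word_adj.
Proof.
case=> [|[k s] w] //; rewrite /word_adj /= eqseq_cons xpair_eqE !eqxx /= andbT.
have -> : w == (k, s) :: w = false.
  by apply/eqP=> /(congr1 size) /= /eqP; rewrite -[_ == _]/(_ == _) ltn_eqF.
by case: s.
Qed.

Variant word_adj_spec (u v : word) : Prop :=
  | AdjChild x of v = x :: u
  | AdjParent x of u = x :: v
  | AdjSibling k s w of u = (k, s) :: w & v = (k, ~~ s) :: w.

Lemma word_adjP u v : word_adj u v -> word_adj_spec u v.
Proof.
case/or3P.
- by case: v => [|x w] //= /eqP->; apply: AdjChild.
- by case: u => [|x w] //= /eqP->; apply: AdjParent.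
- by case: u => [|[k s] w] //= /eqP->; apply: AdjSibling.
Qed.

Lemma adj_child x w : word_adj w (x :: w).
Proof. by rewrite /word_adj /= eqxx. Qed.
Lemma adj_parent x w : word_adj (x :: w) w.
Proof. by rewrite word_adj_sym adj_child. Qed.
Lemma adj_sibling k s w : word_adj ((k, s) :: w) ((k, ~~ s) :: w).
Proof. by rewrite /word_adj /= eqxx !orbT. Qed.

(** Impossible equations between words are refuted by their lengths or, failing that, letter by
    letter. *)
Ltac refute_words :=
  rewrite /not; intros; exfalso;
  repeat match goal with H : @eq _ ?a ?b |- _ =>
    lazymatch goal with
    | _ : @size (bool*bool) a = @size (bool*bool) b |- _ => fail
    | _ => let Hs := fresh "Hs" in have Hs := congr1 (@size (bool * bool)) H
    end end;
  simpl in *; first [lia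
    | repeat match goal with b : bool |- _ => destruct b end; simpl in *; congruence].

Ltac no_common_neighbour :=
  move=> ?; apply/negP=> /andP[/word_adjP + /word_adjP];
  let h := fresh in move=> h; case; intros; destruct h; refute_words.

(** * Pairs of words at distance 3 *)

Lemma dist3_cousins x y k s w :
  dist3 word_adj (x :: (k, s) :: w) (y :: (k, ~~ s) :: w).
Proof.
split.
- exists ((k, s) :: w), ((k, ~~ s) :: w).
  by rewrite adj_parent adj_sibling adj_child.
- refute_words.
- by apply/negP=> /word_adjP[]; refute_words.
no_common_neighbour.
Qed.

Lemma dist3_nephew x k s s' w :
  dist3 word_adj ((k, s) :: w) (x :: (~~ k, s') :: w).
Proof.
split.
- exists w, ((~~ k, s') :: w).
  by rewrite adj_parent !adj_child.
- refute_words.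
- by apply/negP=> /word_adjP[]; refute_words.
no_common_neighbour.
Qed.

Lemma dist3_grandnephew x y k s w :
  dist3 word_adj ((k, ~~ s) :: w) (y :: x :: (k, s) :: w).
Proof.
split.
- exists ((k, s) :: w), (x :: (k, s) :: w).
  by rewrite word_adj_sym adj_sibling !adj_child.
- refute_words.
- by apply/negP=> /word_adjP[]; refute_words.
no_common_neighbour.
Qed.

Lemma dist3_descendant x y z w : dist3 word_adj w (z :: y :: x :: w).
Proof.
split.
- by exists (x :: w), (y :: x :: w); rewrite !adj_child.
- refute_words.
- by apply/negP=> /word_adjP[]; refute_words.
no_common_neighbour.
Qed.

Lemma size_word_adj u v : word_adj u v -> size v <= (size u).+1.
Proof. by case/word_adjP=> [x ->|x ->|k s w -> ->] /=; lia. Qed.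

Section Cactus.
Variable n : nat.

Definition cactus_edge : rel {bseq n of bool * bool} := fun u v => word_adj u v.

Fact cactus_sym : symmetric cactus_edge.
Proof. by move=> u v; apply: word_adj_sym. Qed.

Fact cactus_irr : irreflexive cactus_edge.
Proof. by move=> u; apply: word_adj_irr. Qed.

Definition cactus : sgraph := SGraph cactus_sym cactus_irr.

Definition node (w : word) : cactus := insub_bseq n w.

Lemma nodeK (w : word) : size w <= n -> val (node w) = w.
Proof. by move=> wn; rewrite /node /insub_bseq insubdK. Qed.

(* The strict bounds keep the inner vertices of the path within length n. *)
Lemma dist3_node (u v : word) : size u < n -> size v < n ->
  dist3 word_adj u v -> dist3 edge (node u) (node v).
Proof.
move=> un vn [[a [b [ua ab bv]]] ne nuv nz].
have an : size a <= n by apply: leq_trans (size_word_adj ua) un.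
have bn : size b <= n.
  by rewrite word_adj_sym in bv; apply: leq_trans (size_word_adj bv) vn.
split; rewrite /= /cactus_edge.
- by exists (node a), (node b); rewrite !nodeK // ltnW.
- by move/(congr1 val); rewrite !nodeK // ltnW.
- by rewrite !nodeK // ltnW.
- by move=> z; rewrite !nodeK // ltnW.
Qed.

Lemma cactus_width : elim_width 2 cactus.
Proof.
(* The graph is already chordal. Doubling the length leaves room to place the sibling with
   [s = true] just after the other one. *)
pose lev (u : word) := if u is (_, s) :: w then ((size w).+1).*2 + s else 0.
pose B (u : word) : seq word :=
  if u is (k, s) :: w then w :: (if s then [:: (k, false) :: w] else [::]) else [::].
have sB u v : v \in B u -> size v <= size u.
  by case: u => [|[k []] w] //=; rewrite !inE;
    [case/orP=> /eqP-> /= | move/eqP-> => /=].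
have mB (u v : cactus) : (v \in map node (B (val u))) = (val v \in B (val u)).
  apply/mapP/idP => [[w wB ->]|vB]; last by exists (val v); rewrite // /node /insub_bseq valKd.
  by rewrite nodeK // (leq_trans (sB _ _ wB)) // size_bseq.
exists (fun u => lev (val u)), (fun u => map node (B (val u))); split.
- by move=> u; rewrite size_map; case: (val u) => [|[k []] w].
- move=> v u; rewrite mB; case: (val u) => [|[k s] w] //=.
  have lw : lev w < (size w).+1.*2 by case: (w) => [|[k' []] w'] //=; lia.
  case: s; rewrite !inE; last by move/eqP->; rewrite addn0.
  by case/orP=> /eqP->; [apply: ltn_addr | rewrite /lev addn0 addn1].
- move=> u v uv; rewrite !mB; case/word_adjP: (uv : word_adj (val u) (val v)) => [[k s] ->|[k s] ->|k s w -> ->] /=.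
  + by rewrite inE eqxx.
  + by rewrite inE eqxx orbT.
  + by case: s; rewrite /= !inE eqxx !orbT.
move=> u v w; rewrite !mB -val_eqE; case: (val u) => [|[k s] x] //=.
case: s; rewrite !inE; last by move=> /eqP-> /eqP->; rewrite eqxx.
by move=> /orP[]/eqP-> /orP[]/eqP->; rewrite ?eqxx //= !inE !eqxx ?orbT.
Qed.

End Cactus.

(** * Four colours do not suffice for the tree of triangles *)

Section Coloring.
Variables (C : finType) (f : cactus 6 -> C).
Hypothesis f_proper : proper3 f.
Hypothesis card_C : #|C| <= 4.

Let c (w : word) : C := f (node 6 w).

Let cP u v : size u < 6 -> size v < 6 -> dist3 word_adj u v -> c u <> c v.
Proof. by move=> un vn uv; apply/f_proper/dist3_node. Qed.

Let S1 (w : word) : {set C} := [set c (x :: w) | x in {: bool * bool}].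
Let S2 (w : word) : {set C} := \bigcup_(x : bool * bool) S1 (x :: w).

Lemma mem_S1 x w : c (x :: w) \in S1 w.
Proof. exact: imset_f. Qed.

Lemma S1_S2 x w : S1 (x :: w) \subset S2 w.
Proof. exact: bigcup_sup. Qed.

Lemma S1P a w : a \in S1 w -> exists x, a = c (x :: w).
Proof. by case/imsetP=> x _; exists x. Qed.

Lemma S2P a w : a \in S2 w -> exists x y, a = c (y :: x :: w).
Proof. by case/bigcupP=> x _ /S1P[y ->]; exists x, y. Qed.

Lemma S1_gt0 w : 0 < #|S1 w|.
Proof. by apply/card_gt0P; exists (c ((true, true) :: w)); apply: mem_S1. Qed.

Lemma S1_sibling k s w : size w < 4 ->
  [disjoint S1 ((k, s) :: w) & S1 ((k, ~~ s) :: w)].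
Proof.
move=> wn; rewrite disjoint_subset; apply/subsetP=> a /S1P[x ->]; rewrite inE.
by apply/negP=> /S1P[y]; apply: cP (dist3_cousins _ _ _ _ _).
Qed.

Lemma S1_other k s s' w : size w < 4 -> c ((k, s) :: w) \notin S1 ((~~ k, s') :: w).
Proof.
by move=> wn; apply/negP=> /S1P[y]; apply: cP (dist3_nephew _ _ _ _ _) => //; apply: ltnW.
Qed.

Lemma S2_sibling k s w : size w < 3 -> c ((k, ~~ s) :: w) \notin S2 ((k, s) :: w).
Proof.
move=> wn; apply/negP=> /S2P[x [y]]; apply: cP (dist3_grandnephew _ _ _ _ _) => /=; lia.
Qed.

Lemma S2_parent x w : size w < 3 -> c w \notin S2 (x :: w).
Proof.
move=> wn; apply/negP=> /S2P[y [z]]; apply: cP (dist3_descendant _ _ _ _) => /=; lia.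
Qed.

(** The children in the other triangle also have colour [a], and they are at distance 3 from the
    grandchild in question. *)
Lemma S2_single a w : size w < 4 -> S1 w = [set a] -> a \notin S2 w.
Proof.
move=> wn Sa; apply/negP=> /bigcupP[[k s] _].
have <- : c ((~~ k, s) :: w) = a by apply/set1P; rewrite -Sa mem_S1.
by apply/negP; rewrite -{2}[k]negbK; apply: S1_other.
Qed.

Lemma card_siblings k s w (D : {set C}) : size w < 4 ->
  S1 ((k, s) :: w) \subset D -> S1 ((k, ~~ s) :: w) \subset D ->
  #|S1 ((k, s) :: w)| + #|S1 ((k, ~~ s) :: w)| <= #|D|.
Proof.
move=> wn h1 h2; have := leq_card_setU (S1 ((k, s) :: w)) (S1 ((k, ~~ s) :: w)).
case=> _; rewrite S1_sibling // => /eqP<-.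
by apply: subset_leq_card; rewrite subUset h1.
Qed.

Let full w := S1 w :|: S2 w == setT.

Lemma full_parent x w : size w < 3 -> full (x :: w) -> c w \in S1 (x :: w).
Proof.
by move=> wn /eqP/setP/(_ (c w)); rewrite !inE (negPf (S2_parent _ wn)) orbF.
Qed.

Lemma full_sibling k s w :
  size w < 3 -> full ((k, s) :: w) -> c ((k, ~~ s) :: w) \in S1 ((k, s) :: w).
Proof.
move=> wn /eqP/setP/(_ (c ((k, ~~ s) :: w))).
by rewrite !inE (negPf (S2_sibling _ _ wn)) orbF.
Qed.

Lemma not_both_full k s w : size w < 3 ->
  ~~ full ((k, s) :: w) || ~~ full ((k, ~~ s) :: w).
Proof.
move=> wn; rewrite -negb_and; apply/negP=> /andP[f1 f2].
have /disjointFr := S1_sibling k s (ltnW wn : size w < 4).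
by move/(_ _ (full_parent wn f1)); rewrite (full_parent wn f2).
Qed.

(** Since [S2 w] misses [a] and one further colour, it has at most two elements; the disjoint
    nonempty sets [S1] of two siblings share them. *)
Lemma not_full_single_child a w x : size w < 4 ->
  S1 w = [set a] -> ~~ full w -> exists b, S1 (x :: w) = [set b].
Proof.
case: x => k s wn Sa nf; apply/cards1P.
have aS2 := S2_single wn Sa.
have : #|S1 w :|: S2 w| < #|C| by rewrite -cardsT; apply: proper_card; rewrite properT.
rewrite Sa cardsU1 aS2 => S2_lt.
have := card_siblings wn (S1_S2 (k, s) w) (S1_S2 (k, ~~ s) w).
have := S1_gt0 ((k, s) :: w); have := S1_gt0 ((k, ~~ s) :: w).
by move: S2_lt card_C; rewrite add1n; lia.
Qed.

Lemma single_full a w : size w < 2 -> S1 w = [set a] -> full w.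
Proof.
move=> wn Sa; apply/negPn/negP=> nf.
have w4 : size w < 4 by lia.
have [s nfs] : exists s, ~~ full ((true, s) :: w).
  by case/orP: (@not_both_full true true w (leqW wn)); [exists true | exists false].
set v := (true, s) :: w in nfs.
have [b Sb] := not_full_single_child (true, s) w4 Sa nf.
have [v3 v4] : size v < 3 /\ size v < 4 by rewrite /=; lia.
set y := (true, true) :: v; set y' := (true, false) :: v.
have [d Sd] := not_full_single_child (true, true) v4 Sb nfs.
have y4 : size y < 4 by rewrite /=; lia.
have cv : c v = a by apply/set1P; rewrite -Sa mem_S1.
have cv' : c ((true, ~~ s) :: w) = a by apply/set1P; rewrite -Sa mem_S1.
have cy' : c y' = b by apply/set1P; rewrite -Sb mem_S1.
have aS2 := S2_single w4 Sa; have bS2 := S2_single v4 Sb.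
(* The colours [a], [b], [d] are distinct: [S2 w] misses [a], while [S2 v] misses [b] and also [a],
   the colour of the sibling of [v]. *)
have bw : b \in S2 w.
  by apply: (subsetP (S1_S2 (true, s) w)); rewrite Sb set11.
have dv : d \in S2 v.
  by apply: (subsetP (S1_S2 (true, true) v)); rewrite Sd set11.
have av : a \notin S2 v by rewrite -cv'; apply: S2_sibling; apply: leqW.
have db : d != b by apply: contraNneq bS2 => <-.
have ba : b != a by apply: contraNneq aS2 => <-.
have da : d != a by apply: contraNneq av => <-.
(* Here [d] is excluded by [S1 y], [b] is the colour of the sibling [y'], and [a] that of the parent
   [v]. *)
have S2y : S2 y \subset ~: [set d; b; a].
  apply/subsetP=> z zy; rewrite !inE !negb_or -andbA; apply/and3P; split.
  - by apply: contraNneq (S2_single y4 Sd) => <-.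
  - by apply: contraNneq (S2_sibling true true v3) => zb; rewrite /= -/y' cy' -zb.
  - by apply: contraNneq (S2_parent (true, true) v3) => za; rewrite cv -za.
have card_dba : #|[set d; b; a]| = 3.
  by rewrite setUC cardsU1 cards2 !inE negb_or ![a == _]eq_sym da ba db.
have h (x : bool * bool) : S1 (x :: y) \subset ~: [set d; b; a] by
  apply: subset_trans (S1_S2 x y) S2y.
have := card_siblings y4 (h (true, true)) (h (true, false)).
have := S1_gt0 ((true, true) :: y); have := S1_gt0 ((true, false) :: y).
by move: card_C (cardsC [set d; b; a]); rewrite card_dba; move=> /=; lia.
Qed.

Lemma cactus_coloring_absurd : False.
Proof.
have ex k : exists2 s, c [:: (k, ~~ s)] = c [::] & c [::] \in S1 [:: (k, s)].
  (* The sets [S1] of the two siblings are disjoint and miss the colour of a child in the other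
     triangle, so their sizes add up to at most 3. *)
  have [s [a Sa]] : exists s a, S1 [:: (k, s)] = [set a].
    suff [s /cards1P[a Sa]] : exists s, #|S1 [:: (k, s)]| == 1 by exists s, a.
    have h s : S1 [:: (k, s)] \subset ~: [set c [:: (~~ k, true)]].
      by rewrite subsetC sub1set inE -{2}[k]negbK; apply: S1_other.
    have := @card_siblings k true [::] _ isT (h true) (h false).
    have := cardsC1 (c [:: (~~ k, true)]).
    have := S1_gt0 [:: (k, true)]; have := S1_gt0 [:: (k, false)].
    move: card_C => /= *.
    have [|] : #|S1 [:: (k, true)]| == 1 \/ #|S1 [:: (k, false)]| == 1 by lia.
      by exists true.
    by exists false.
  have fl := @single_full a [:: (k, s)] isT Sa.
  have c0 := @full_parent (k, s) [::] isT fl.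
  (* Fullness puts the colours of the root and of the sibling into the same singleton, so they
     agree. *)
  exists s => //; have := @full_sibling k s [::] isT fl.
  by move: c0; rewrite Sa !inE => /eqP-> /eqP.
(* A child in one triangle has the colour of the root, which also occurs below a child in the other
   triangle, at distance 3. *)
have [s e _] := ex true; have [s' _ h] := ex false.
by have := @S1_other true (~~ s) s' [::] isT; rewrite e h.
Qed.

End Coloring.

(** Depth 6 comes from [single_full]: starting at a child of the root, it reaches the grandchildren
    of a word of length 3, and [dist3_node] asks for lengths strictly below the depth. *)
Lemma cactus_needs : needs_colors 5 (cactus 6).
Proof.
move=> C f pf; rewrite ltnNge; apply/negP=> C4; exact: cactus_coloring_absurd pf C4.
Qed.

Theorem mainTheorem7 (t : nat) (ht : 4 <= t) :
  exists G : sgraph,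
    minor_free (complete t) G /\
    2 * (t - 2) + 1 <= chromatic_number (exact_dist_graph G 3).
Proof.
suff [G [wG nG]] : exists G, elim_width (t - 2) G /\ needs_colors (2 * (t - 2) + 1) G.
  exists G; split; last exact: needs_chromatic.
  by have -> : t = (t - 2).+2 by [lia]; apply: elim_width_minor_free.
elim: t ht => // t IH; rewrite leq_eqVlt => /orP[/eqP<-|ht].
  by exists (cactus 6); split; [apply: cactus_width | apply: cactus_needs].
have [G [wG nG]] := IH ht; exists (cone_triangle G).
have -> : t.+1 - 2 = (t - 2).+1 by lia.
split; first by apply: cone_triangle_width => //; lia.
have -> : 2 * (t - 2).+1 + 1 = (2 * (t - 2) + 1).+2 by lia.
exact: cone_triangle_needs.
Qed.
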